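(* Let $S$ be a complete semiring and let $(\mathbf{C},\otimes,I)$ be a small strict monoidal category. Let $Q_S(\mathbf{C})=\prod_{X,Y\in \operatorname{Ob}\mathbf{C}}\{f_{XY}:\operatorname{Hom}_{\mathbf{C}}(X,Y)\to S\}$, equipped with pointwise addition, the pointwise summation law, the zero family $0$, the convolution product $$(f\times g)_{XY}(\gamma)=\sum_{\alpha\otimes\beta=\gamma} g_{X''Y''}(\beta)\cdot f_{X'Y'}(\alpha),$$ and the element $1^\times$ which sends $\operatorname{id}_I$ to $1\in S$ and all other morphisms to $0\in S$. Then $(Q_S(\mathbf{C}),+,\times,0,1^\times)$ is a complete semiring.
   Context: A semiring $(S,+,\cdot,0,1)$ consists of a commutative monoid $(S,+,0)$ and a (not necessarily commutative) monoid $(S,\cdot,1)$ such that $\cdot$ distributes over $+$ from both sides and $0\cdot s=0=s\cdot 0$ for all $s$. A complete monoid is a commutative monoid $(M,+,0)$ with a summation law assigning to every family $(m_i)_{i\in I}$ of elements of $M$, indexed by an arbitrary set $I$, an element $\sum_{i\in I}m_i\in M$ such that $\sum_{i\in\varnothing}m_i=0$, $\sum_{i\in\{1\}}m_i=m_1$, $\sum_{i\in\{1,2\}}m_i=m_1+m_2$, and $\sum_{j\in J}\big(\sum_{i\in I_j}m_i\big)=\sum_{i\in I}m_i$ for every partition $I=\bigcup_{j\in J}I_j$. A semiring is complete if $(S,+,0,\sum)$ is a complete monoid and $\sum_i ss_i=s\sum_i s_i$, $\sum_i s_is=(\sum_i s_i)s$ for all families and all $s\in S$. The operations on $Q_S(\mathbf{C})$: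 for families $f=(f_{XY})$, $g=(g_{XY})$, $(f+g)_{XY}(\gamma)=f_{XY}(\gamma)+g_{XY}(\gamma)$; for a family $(f_j)_{j\in J}$, $(\sum_{j\in J} f_j)_{XY}(\gamma)=\sum_{j\in J}(f_j)_{XY}(\gamma)$ using the summation law of $S$. In the formula for $f\times g$, the sum (taken with the summation law of $S$) runs over all pairs $(\alpha,\beta)$ of morphisms $\alpha\in\operatorname{Hom}_{\mathbf{C}}(X',Y')$, $\beta\in\operatorname{Hom}_{\mathbf{C}}(X'',Y'')$ with $X=X'\otimes X''$, $Y=Y'\otimes Y''$ and $\alpha\otimes\beta=\gamma:X\to Y$. *)

(* Defs.v *)
From mathcomp Require Import all_boot all_algebra.
From mathcomp Require Import boolp.

Set Implicit Arguments.
Unset Strict Implicit.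
Unset Printing Implicit Defensive.

Import GRing.Theory.
Local Open Scope ring_scope.

Definition summation (M : Type) : Type := forall I : Type, (I -> M) -> M.

(** The laws for index sets with no, one and two elements are stated for all
    such index types. A partition of [I] indexed by [J] is given by its blocks
    [P j]; as usual for summation laws, blocks may be empty. *)
Record is_complete_monoid (M : nmodType) (Sum : summation M) : Prop := {
  sum_empty : forall (I : Type) (m : I -> M), (I -> False) -> Sum I m = 0;
  sum_singleton : forall (I : Type) (m : I -> M) (i1 : I),
    (forall i, i = i1) -> Sum I m = m i1;
  sum_pair : forall (I : Type) (m : I -> M) (i1 i2 : I),
    i1 <> i2 -> (forall i, i = i1 \/ i = i2) -> Sum I m = m i1 + m i2;
  sum_partition : forall (I J : Type) (P : J -> I -> Prop) (m : I -> M),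
    (forall i, exists! j, P j i) ->
    Sum J (fun j => Sum {i : I | P j i} (fun i => m (sval i))) = Sum I m
}.

Record is_complete_semiring (S : pzSemiRingType) (Sum : summation S) : Prop := {
  complete_semiring_monoid : is_complete_monoid Sum;
  sum_mull : forall (I : Type) (m : I -> S) (s : S),
    Sum I (fun i => s * m i) = s * Sum I m;
  sum_mulr : forall (I : Type) (m : I -> S) (s : S),
    Sum I (fun i => m i * s) = Sum I m * s
}.

(** [(T, add, mul, zero, one)] with the summation law [Sum] is a complete
    semiring. [pzSemiRingType] does not require [0 != 1]; the decidable equality
    and choice operator it also carries are no restriction, since [boolp]
    provides them on every type. *)
Definition forms_complete_semiring (T : Type) (add mul : T -> T -> T)
    (zero one : T) (Sum : summation T) : Prop :=
  exists c : GRing.PzSemiRing.axioms_ T,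
    let R : pzSemiRingType := GRing.PzSemiRing.Pack c in
    [/\ @GRing.add R = add, @GRing.mul R = mul, @GRing.zero R = zero,
        @GRing.one R = one & @is_complete_semiring R Sum].

Record category := Category {
  Ob :> Type;
  Hom : Ob -> Ob -> Type;
  idm : forall X, Hom X X;
  compm : forall X Y Z, Hom Y Z -> Hom X Y -> Hom X Z;
  compm_idl : forall X Y (f : Hom X Y), compm (idm Y) f = f;
  compm_idr : forall X Y (f : Hom X Y), compm f (idm X) = f;
  compmA : forall W X Y Z (h : Hom Y Z) (g : Hom X Y) (f : Hom W X),
    compm h (compm g f) = compm (compm h g) f
}.

(** A morphism together with its domain and codomain: equality in [arrow C]
    compares morphisms whose hom-sets are only propositionally equal. *)
Record arrow (C : category) := Arrow {
  dom : C;
  cod : C;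
  mor : Hom dom cod
}.
Arguments Arrow {C dom cod} mor.

Record strictMonoidalCategory := StrictMonoidalCategory {
  smc_cat :> category;
  unit_ob : smc_cat;
  tensor_ob : smc_cat -> smc_cat -> smc_cat;
  tensor : forall X' Y' X'' Y'' : smc_cat, Hom X' Y' -> Hom X'' Y'' ->
    Hom (tensor_ob X' X'') (tensor_ob Y' Y'');
  tensor_id : forall X Y : smc_cat,
    tensor (idm X) (idm Y) = idm (tensor_ob X Y);
  tensor_compm : forall (X Y Z X' Y' Z' : smc_cat)
      (g : Hom Y Z) (f : Hom X Y) (g' : Hom Y' Z') (f' : Hom X' Y'),
    tensor (compm g f) (compm g' f') = compm (tensor g g') (tensor f f');
  tensor_obA : forall X Y Z : smc_cat,
    tensor_ob X (tensor_ob Y Z) = tensor_ob (tensor_ob X Y) Z;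
  tensor_ob1l : forall X : smc_cat, tensor_ob unit_ob X = X;
  tensor_ob1r : forall X : smc_cat, tensor_ob X unit_ob = X;
  tensorA : forall (X X' Y Y' Z Z' : smc_cat)
      (f : Hom X X') (g : Hom Y Y') (h : Hom Z Z'),
    Arrow (tensor f (tensor g h)) = Arrow (tensor (tensor f g) h);
  tensor1l : forall (X Y : smc_cat) (f : Hom X Y),
    Arrow (tensor (idm unit_ob) f) = Arrow f;
  tensor1r : forall (X Y : smc_cat) (f : Hom X Y),
    Arrow (tensor f (idm unit_ob)) = Arrow f
}.

Definition Q (S : pzSemiRingType) (C : strictMonoidalCategory) : Type :=
  forall X Y : C, Hom X Y -> S.

(** The pairs [(alpha, beta)] with [alpha ⊗ beta = gamma]; the equality in
    [arrow C] includes [X' ⊗ X'' = X] and [Y' ⊗ Y'' = Y]. *)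
Record factorization (C : strictMonoidalCategory) (X Y : C) (gamma : Hom X Y) :=
  Factorization {
    alpha : arrow C;
    beta : arrow C;
    factorizationE : Arrow (tensor (mor alpha) (mor beta)) = Arrow gamma
  }.

Definition Qadd (S : pzSemiRingType) (C : strictMonoidalCategory)
    (f g : Q S C) : Q S C :=
  fun X Y gamma => f X Y gamma + g X Y gamma.

Definition Qzero (S : pzSemiRingType) (C : strictMonoidalCategory) : Q S C :=
  fun _ _ _ => 0.

Definition Qsum (S : pzSemiRingType) (Sum : summation S)
    (C : strictMonoidalCategory) : summation (Q S C) :=
  fun J f X Y gamma => Sum J (fun j => f j X Y gamma).

Definition Qmul (S : pzSemiRingType) (Sum : summation S)
    (C : strictMonoidalCategory) (f g : Q S C) : Q S C :=
  fun X Y gamma =>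
    Sum (factorization gamma) (fun p =>
      g (dom (beta p)) (cod (beta p)) (mor (beta p))
      * f (dom (alpha p)) (cod (alpha p)) (mor (alpha p))).

Definition Qone (S : pzSemiRingType) (C : strictMonoidalCategory) : Q S C :=
  fun X Y gamma =>
    if `[< Arrow gamma = Arrow (idm (unit_ob C)) >] then 1 else 0.

Arguments Qadd S C f g : clear implicits.
Arguments Qzero S C : clear implicits.
Arguments Qsum {S} Sum C.
Arguments Qmul {S} Sum C f g.
Arguments Qone S C : clear implicits.

(* Main.v *)
From mathcomp Require Import all_boot all_algebra.
From HB Require Import structures.
From mathcomp Require Import boolp.
Require Import Defs.

(** Every law of [Q S C] is checked at a fixed morphism [gamma], where it
    becomes an identity between sums in [S]. Everything that does not involve
    the convolution is inherited pointwise from [S]. For the convolution: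

    - Associativity. Since [S] distributes over arbitrary sums, both
      [((f * g) * h) gamma] and [(f * (g * h)) gamma] are iterated sums of
      [h c * (g b * f a)]: the first over the factorizations of [gamma] as
      [d ⊗ c] and then of [d] as [a ⊗ b], the second over those as [a ⊗ d] and
      then of [d] as [b ⊗ c]. Strict associativity of the tensor product turns
      both into a sum over the triples with [(a ⊗ b) ⊗ c = gamma]
      ([Qmul_tripl], [Qmul_tripr]).
    - Unit. Only factorizations with [id_I] as the relevant factor contribute,
      and strictness of the unit leaves exactly one of them, the other factor
      being [gamma] itself.
    - Distributivity over sums, finite or not, is the interchange of two
      summations ([sum_exchange]).

    All the rearrangements come from one principle, [sum_fibration]: a sum may
    be computed along any map out of its index set, with each fibre replaced by
    a set in bijection with it. It avoids equalities in dependent sum types: only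
    pairs and triples of arrows, whose defining equations are irrelevant, are
    ever compared. *)

Set Implicit Arguments.
Unset Strict Implicit.
Unset Printing Implicit Defensive.

Import GRing.Theory.
Local Open Scope ring_scope.

(** * Summation in complete monoids *)

Lemma eq_sum (M : Type) (Sum : summation M) (I : Type) (m n : I -> M) :
  (forall i, m i = n i) -> Sum I m = Sum I n.
Proof. by move=> /funext ->. Qed.

Lemma sval_eq (T : Type) (P : T -> Prop) (x y : {t | P t}) :
  sval x = sval y -> x = y.
Proof. by case: x y => [x Px] [y Py] /= xy; apply: eq_exist. Qed.

(** Each zero is an empty sum, so the whole is a sum over a partition of the
    empty set into empty blocks. *)
Lemma sum_zero (M : nmodType) (Sum : summation M)
    (M_complete : is_complete_monoid Sum) (I : Type) :
  Sum I (fun=> 0) = 0.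
Proof.
have part (x : False) : exists! i : I, False by [].
have := sum_partition M_complete (fun x : False => 0) part.
rewrite (sum_empty M_complete (fun x : False => 0)) // => sum0.
rewrite -[RHS]sum0; apply: eq_sum => i.
by rewrite (sum_empty M_complete) // => -[].
Qed.

(** Only the partition law relates sums over different index types; here the
    range of [e] is partitioned into the singletons [{e k}]. *)
Lemma sum_image (M : nmodType) (Sum : summation M)
    (M_complete : is_complete_monoid Sum) (I K : Type) (e : K -> I)
    (m : I -> M) :
  (forall k k', e k = e k' -> k = k') ->
  Sum {i | exists k, e k = i} (fun i => m (sval i)) = Sum K (fun k => m (e k)).
Proof.
move=> e_inj.
have part (i : {i | exists k, e k = i}) : exists! k, e k = sval i.
  by case: i => i [k /= eki]; exists k; split=> // k' ek'i; apply: e_inj; rewrite eki.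
rewrite -(sum_partition M_complete (fun i => m (sval i)) part).
apply: eq_sum => k.
pose ek : {i | exists k, e k = i} := exist _ (e k) (ex_intro _ k erefl).
have ekP : e k = sval ek by [].
rewrite (sum_singleton M_complete _ (i1 := exist _ ek ekP)) // => -[i ki].
exact/sval_eq/sval_eq.
Qed.

(** Summation along [p], the fibre over [j] being parametrized by [K j] through
    [e j]. Reindexing and all interchanges of summations are instances. *)
Lemma sum_fibration (M : nmodType) (Sum : summation M)
    (M_complete : is_complete_monoid Sum) (I J : Type) (K : J -> Type)
    (p : I -> J) (e : forall j, K j -> I) (m : I -> M) :
    (forall j k, p (e j k) = j) ->
    (forall j k k', e j k = e j k' -> k = k') ->
    (forall i, exists k, e (p i) k = i) ->
  Sum J (fun j => Sum (K j) (fun k => m (e j k))) = Sum I m.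
Proof.
move=> pe e_inj e_surj.
have part i : exists! j, exists k, e j k = i.
  by exists (p i); split=> // j [k <-].
rewrite -(sum_partition M_complete m part); apply: eq_sum => j.
by rewrite (sum_image M_complete m (e_inj j)).
Qed.

Lemma sum_exchange (M : nmodType) (Sum : summation M)
    (M_complete : is_complete_monoid Sum) (I J : Type) (m : I -> J -> M) :
  Sum I (fun i => Sum J (m i)) = Sum J (fun j => Sum I (m^~ j)).
Proof.
transitivity (Sum (I * J)%type (fun x => m x.1 x.2)).
  apply: (sum_fibration M_complete (p := fst) (e := fun i j => (i, j))
            (fun x => m x.1 x.2)) => //.
  - by move=> i j j' [].
  - by case=> i j; exists j.
symmetry; apply: (sum_fibration M_complete (p := snd)
  (e := fun j i => (i, j)) (fun x => m x.1 x.2)) => //.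
- by move=> j i i' [].
- by case=> i j; exists i.
Qed.

(** A binary sum is a sum over [bool], so this is an interchange. *)
Lemma sum_add (M : nmodType) (Sum : summation M)
    (M_complete : is_complete_monoid Sum) (I : Type) (m n : I -> M) :
  Sum I (fun i => m i + n i) = Sum I m + Sum I n.
Proof.
have sum2 (q : bool -> M) : Sum bool q = q true + q false.
  by apply: (sum_pair M_complete) => // -[]; [left|right].
pose q i (b : bool) := if b then m i else n i.
rewrite (eq_sum Sum (n := fun i => Sum bool (q i))); last by move=> i; rewrite sum2.
by rewrite (sum_exchange M_complete) sum2.
Qed.

(** Split the index set into [i0] and the rest, whose sum vanishes. *)
Lemma sum_supported_at (M : nmodType) (Sum : summation M)
    (M_complete : is_complete_monoid Sum) (I : Type) (m : I -> M) (i0 : I) :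
  (forall i, i <> i0 -> m i = 0) -> Sum I m = m i0.
Proof.
move=> m0; pose P (b : bool) i := `[< i = i0 >] = b.
have part i : exists! b, P b i by exists `[< i = i0 >].
rewrite -(sum_partition M_complete m part).
rewrite (sum_pair M_complete _ (i1 := true) (i2 := false)) //; last first.
  by case; [left|right].
have P0 : P true i0 by apply/asboolP.
rewrite (sum_singleton M_complete _ (i1 := exist _ i0 P0)); last first.
  by case=> i Pi; apply: sval_eq; apply/asboolP.
rewrite (eq_sum Sum (n := fun=> 0)) ?(sum_zero M_complete) ?addr0 //.
by case=> i /= /asboolPn/m0.
Qed.

(** * Factorizations of a morphism *)

Definition tensor_arrow (C : strictMonoidalCategory) (a b : arrow C) : arrow C :=
  Arrow (tensor (mor a) (mor b)).

Definition unit_arrow (C : strictMonoidalCategory) : arrow C :=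
  Arrow (idm (unit_ob C)).

Lemma Arrow_mor (C : category) (a : arrow C) : Arrow (mor a) = a.
Proof. by case: a. Qed.

Lemma tensor_arrowA (C : strictMonoidalCategory) (a b c : arrow C) :
  tensor_arrow a (tensor_arrow b c) = tensor_arrow (tensor_arrow a b) c.
Proof. exact: tensorA. Qed.

Lemma tensor_arrow1l (C : strictMonoidalCategory) (a : arrow C) :
  tensor_arrow (unit_arrow C) a = a.
Proof. by rewrite -[RHS]Arrow_mor -tensor1l. Qed.

Lemma tensor_arrow1r (C : strictMonoidalCategory) (a : arrow C) :
  tensor_arrow a (unit_arrow C) = a.
Proof. by rewrite -[RHS]Arrow_mor -tensor1r. Qed.

Lemma factorization_eq (C : strictMonoidalCategory) (X Y : C)
    (gamma : Hom X Y) (p q : factorization gamma) :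
  alpha p = alpha q -> beta p = beta q -> p = q.
Proof.
case: p q => [a b E] [a' b' E'] /= eqa eqb; subst a' b'.
by congr Factorization; apply: Prop_irrelevance.
Qed.

Record triple_factorization (C : strictMonoidalCategory) (X Y : C)
    (gamma : Hom X Y) := TripleFactorization {
  factor1 : arrow C;
  factor2 : arrow C;
  factor3 : arrow C;
  triple_factorizationE :
    tensor_arrow (tensor_arrow factor1 factor2) factor3 = Arrow gamma
}.

Lemma triple_factorization_eq (C : strictMonoidalCategory) (X Y : C)
    (gamma : Hom X Y) (s t : triple_factorization gamma) :
  factor1 s = factor1 t -> factor2 s = factor2 t -> factor3 s = factor3 t ->
  s = t.
Proof.
case: s t => [a b c E] [a' b' c' E'] /= eqa eqb eqc; subst a' b' c'.
by congr TripleFactorization; apply: Prop_irrelevance.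
Qed.

Definition merge_left (C : strictMonoidalCategory) (X Y : C)
    (gamma : Hom X Y) (t : triple_factorization gamma) : factorization gamma :=
  Factorization (triple_factorizationE t).

Lemma merge_right_subproof (C : strictMonoidalCategory) (X Y : C)
    (gamma : Hom X Y) (t : triple_factorization gamma) :
  tensor_arrow (factor1 t) (tensor_arrow (factor2 t) (factor3 t)) = Arrow gamma.
Proof. by rewrite tensor_arrowA triple_factorizationE. Qed.

Definition merge_right (C : strictMonoidalCategory) (X Y : C)
    (gamma : Hom X Y) (t : triple_factorization gamma) : factorization gamma :=
  Factorization (merge_right_subproof t).

Lemma split_left_subproof (C : strictMonoidalCategory) (X Y : C)
    (gamma : Hom X Y) (p : factorization gamma)
    (q : factorization (mor (alpha p))) :
  tensor_arrow (tensor_arrow (alpha q) (beta q)) (beta p) = Arrow gamma.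
Proof.
have -> : tensor_arrow (alpha q) (beta q) = alpha p.
  by rewrite -[RHS]Arrow_mor -(factorizationE q).
exact: factorizationE p.
Qed.

Definition split_left (C : strictMonoidalCategory) (X Y : C)
    (gamma : Hom X Y) (p : factorization gamma)
    (q : factorization (mor (alpha p))) : triple_factorization gamma :=
  TripleFactorization (split_left_subproof q).

Lemma split_right_subproof (C : strictMonoidalCategory) (X Y : C)
    (gamma : Hom X Y) (p : factorization gamma)
    (q : factorization (mor (beta p))) :
  tensor_arrow (tensor_arrow (alpha p) (alpha q)) (beta q) = Arrow gamma.
Proof.
rewrite -tensor_arrowA.
have -> : tensor_arrow (alpha q) (beta q) = beta p.
  by rewrite -[RHS]Arrow_mor -(factorizationE q).
exact: factorizationE p.
Qed.

Definition split_right (C : strictMonoidalCategory) (X Y : C)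
    (gamma : Hom X Y) (p : factorization gamma)
    (q : factorization (mor (beta p))) : triple_factorization gamma :=
  TripleFactorization (split_right_subproof q).

(** The triples lying over [p] are the factorizations of its first factor. *)
Lemma sum_split_left (M : nmodType) (Sum : summation M)
    (M_complete : is_complete_monoid Sum) (C : strictMonoidalCategory)
    (X Y : C) (gamma : Hom X Y) (m : triple_factorization gamma -> M) :
  Sum (factorization gamma) (fun p =>
    Sum (factorization (mor (alpha p))) (fun q => m (split_left q)))
  = Sum (triple_factorization gamma) m.
Proof.
apply: (sum_fibration M_complete (p := @merge_left _ _ _ gamma)
         (e := @split_left _ _ _ gamma)) => [p q|p q q'|t].
- apply: factorization_eq => //=.
  by rewrite -[RHS]Arrow_mor -(factorizationE q).
- case=> eqa eqb; exact: factorization_eq.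
- pose q : factorization (mor (alpha (merge_left t))) :=
    @Factorization _ _ _ (tensor (mor (factor1 t)) (mor (factor2 t)))
      (factor1 t) (factor2 t) erefl.
  by exists q; apply: triple_factorization_eq.
Qed.

(** Strict associativity rebrackets the triples, so that those lying over [p]
    are the factorizations of its second factor. *)
Lemma sum_split_right (M : nmodType) (Sum : summation M)
    (M_complete : is_complete_monoid Sum) (C : strictMonoidalCategory)
    (X Y : C) (gamma : Hom X Y) (m : triple_factorization gamma -> M) :
  Sum (factorization gamma) (fun p =>
    Sum (factorization (mor (beta p))) (fun q => m (split_right q)))
  = Sum (triple_factorization gamma) m.
Proof.
apply: (sum_fibration M_complete (p := @merge_right _ _ _ gamma)
         (e := @split_right _ _ _ gamma)) => [p q|p q q'|t].
- apply: factorization_eq => //=.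
  by rewrite -[RHS]Arrow_mor -(factorizationE q).
- case=> eqa eqb; exact: factorization_eq.
- pose q : factorization (mor (beta (merge_right t))) :=
    @Factorization _ _ _ (tensor (mor (factor2 t)) (mor (factor3 t)))
      (factor2 t) (factor3 t) erefl.
  by exists q; apply: triple_factorization_eq.
Qed.

(** * The convolution product *)

(** Equations between arrows can be rewritten under [Qval f], whereas under [f]
    they would require transporting morphisms along equalities of objects. *)
Definition Qval (S : pzSemiRingType) (C : strictMonoidalCategory)
    (f : Q S C) (a : arrow C) : S :=
  f (dom a) (cod a) (mor a).

Lemma Q_ext (S : pzSemiRingType) (C : strictMonoidalCategory) (f g : Q S C) :
  (forall X Y (gamma : Hom X Y), f X Y gamma = g X Y gamma) -> f = g.
Proof.
move=> fg; apply: functional_extensionality_dep => X.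
apply: functional_extensionality_dep => Y.
by apply: functional_extensionality_dep => gamma.
Qed.

Lemma QmulE (S : pzSemiRingType) (Sum : summation S)
    (C : strictMonoidalCategory) (f g : Q S C) (X Y : C) (gamma : Hom X Y) :
  Qmul Sum C f g X Y gamma
  = Sum (factorization gamma) (fun p => Qval g (beta p) * Qval f (alpha p)).
Proof. by []. Qed.

Lemma Qone_unit (S : pzSemiRingType) (C : strictMonoidalCategory) :
  Qval (Qone S C) (unit_arrow C) = 1.
Proof. by rewrite /Qval /Qone asboolT. Qed.

Lemma Qone_neq (S : pzSemiRingType) (C : strictMonoidalCategory) (a : arrow C) :
  a <> unit_arrow C -> Qval (Qone S C) a = 0.
Proof. by move=> a1; rewrite /Qval /Qone Arrow_mor asboolF. Qed.

(** The factors appear in the order [h], [g], [f] because the convolution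
    multiplies the values in the order opposite to the tensor product. *)
Lemma Qmul_tripl (S : pzSemiRingType) (Sum : summation S)
    (S_complete : is_complete_semiring Sum) (C : strictMonoidalCategory)
    (f g h : Q S C) (X Y : C) (gamma : Hom X Y) :
  Qmul Sum C (Qmul Sum C f g) h X Y gamma
  = Sum (triple_factorization gamma) (fun t =>
      Qval h (factor3 t) * (Qval g (factor2 t) * Qval f (factor1 t))).
Proof.
rewrite -(sum_split_left (complete_semiring_monoid S_complete)).
by apply: eq_sum => p; rewrite -(sum_mull S_complete).
Qed.

Lemma Qmul_tripr (S : pzSemiRingType) (Sum : summation S)
    (S_complete : is_complete_semiring Sum) (C : strictMonoidalCategory)
    (f g h : Q S C) (X Y : C) (gamma : Hom X Y) :
  Qmul Sum C f (Qmul Sum C g h) X Y gamma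
  = Sum (triple_factorization gamma) (fun t =>
      Qval h (factor3 t) * (Qval g (factor2 t) * Qval f (factor1 t))).
Proof.
rewrite -(sum_split_right (complete_semiring_monoid S_complete)).
apply: eq_sum => p; rewrite -(sum_mulr S_complete).
by apply: eq_sum => q; rewrite -mulrA.
Qed.

Lemma QmulA (S : pzSemiRingType) (Sum : summation S)
    (S_complete : is_complete_semiring Sum) (C : strictMonoidalCategory) :
  associative (Qmul Sum C).
Proof.
move=> f g h; apply: Q_ext => X Y gamma.
by rewrite (Qmul_tripr S_complete) (Qmul_tripl S_complete).
Qed.

(** The only factorization with first factor [id_I] is [id_I ⊗ gamma]. *)
Lemma Qmul1l (S : pzSemiRingType) (Sum : summation S)
    (S_complete : is_complete_semiring Sum) (C : strictMonoidalCategory) :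
  left_id (Qone S C) (Qmul Sum C).
Proof.
move=> f; apply: Q_ext => X Y gamma.
pose p0 : factorization gamma :=
  @Factorization _ _ _ gamma (unit_arrow C) (Arrow gamma)
    (tensor_arrow1l (Arrow gamma)).
rewrite QmulE (sum_supported_at (complete_semiring_monoid S_complete)
                 (i0 := p0)); first by rewrite Qone_unit mulr1.
move=> p pp0; rewrite Qone_neq ?mulr0 // => a1.
apply: pp0; apply: factorization_eq => //=.
by rewrite -(factorizationE p) -/(tensor_arrow _ _) a1 tensor_arrow1l.
Qed.

Lemma Qmul1r (S : pzSemiRingType) (Sum : summation S)
    (S_complete : is_complete_semiring Sum) (C : strictMonoidalCategory) :
  right_id (Qone S C) (Qmul Sum C).
Proof.
move=> f; apply: Q_ext => X Y gamma.
pose p0 : factorization gamma :=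
  @Factorization _ _ _ gamma (Arrow gamma) (unit_arrow C)
    (tensor_arrow1r (Arrow gamma)).
rewrite QmulE (sum_supported_at (complete_semiring_monoid S_complete)
                 (i0 := p0)); first by rewrite Qone_unit mul1r.
move=> p pp0; rewrite Qone_neq ?mul0r // => b1.
apply: pp0; apply: factorization_eq => //=.
by rewrite -(factorizationE p) -/(tensor_arrow _ _) b1 tensor_arrow1r.
Qed.

Lemma QmulDl (S : pzSemiRingType) (Sum : summation S)
    (S_complete : is_complete_semiring Sum) (C : strictMonoidalCategory) :
  left_distributive (Qmul Sum C) (Qadd S C).
Proof.
move=> f g h; apply: Q_ext => X Y gamma.
rewrite /Qadd /Qmul -(sum_add (complete_semiring_monoid S_complete)).
by apply: eq_sum => p; rewrite mulrDr.
Qed.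

Lemma QmulDr (S : pzSemiRingType) (Sum : summation S)
    (S_complete : is_complete_semiring Sum) (C : strictMonoidalCategory) :
  right_distributive (Qmul Sum C) (Qadd S C).
Proof.
move=> f g h; apply: Q_ext => X Y gamma.
rewrite /Qadd /Qmul -(sum_add (complete_semiring_monoid S_complete)).
by apply: eq_sum => p; rewrite mulrDl.
Qed.

Lemma Qmul0l (S : pzSemiRingType) (Sum : summation S)
    (S_complete : is_complete_semiring Sum) (C : strictMonoidalCategory) :
  left_zero (Qzero S C) (Qmul Sum C).
Proof.
move=> f; apply: Q_ext => X Y gamma.
rewrite /Qzero -[RHS](sum_zero (complete_semiring_monoid S_complete)
                        (factorization gamma)).
by apply: eq_sum => p; rewrite mulr0.
Qed.

Lemma Qmul0r (S : pzSemiRingType) (Sum : summation S)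
    (S_complete : is_complete_semiring Sum) (C : strictMonoidalCategory) :
  right_zero (Qzero S C) (Qmul Sum C).
Proof.
move=> f; apply: Q_ext => X Y gamma.
rewrite /Qzero -[RHS](sum_zero (complete_semiring_monoid S_complete)
                        (factorization gamma)).
by apply: eq_sum => p; rewrite mul0r.
Qed.

Lemma Qmul_sumr (S : pzSemiRingType) (Sum : summation S)
    (S_complete : is_complete_semiring Sum) (C : strictMonoidalCategory)
    (I : Type) (f : I -> Q S C) (g : Q S C) :
  Qsum Sum C I (fun i => Qmul Sum C g (f i)) = Qmul Sum C g (Qsum Sum C I f).
Proof.
apply: Q_ext => X Y gamma.
rewrite /Qsum /Qmul (sum_exchange (complete_semiring_monoid S_complete)).
by apply: eq_sum => p; rewrite (sum_mulr S_complete).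
Qed.

Lemma Qmul_suml (S : pzSemiRingType) (Sum : summation S)
    (S_complete : is_complete_semiring Sum) (C : strictMonoidalCategory)
    (I : Type) (f : I -> Q S C) (g : Q S C) :
  Qsum Sum C I (fun i => Qmul Sum C (f i) g) = Qmul Sum C (Qsum Sum C I f) g.
Proof.
apply: Q_ext => X Y gamma.
rewrite /Qsum /Qmul (sum_exchange (complete_semiring_monoid S_complete)).
by apply: eq_sum => p; rewrite (sum_mull S_complete).
Qed.

(** * The complete semiring *)

Lemma QaddA (S : pzSemiRingType) (C : strictMonoidalCategory) :
  associative (Qadd S C).
Proof. by move=> f g h; apply: Q_ext => X Y gamma; apply: addrA. Qed.

Lemma QaddC (S : pzSemiRingType) (C : strictMonoidalCategory) :
  commutative (Qadd S C).
Proof. by move=> f g; apply: Q_ext => X Y gamma; apply: addrC. Qed.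

Lemma Qadd0l (S : pzSemiRingType) (C : strictMonoidalCategory) :
  left_id (Qzero S C) (Qadd S C).
Proof. by move=> f; apply: Q_ext => X Y gamma; apply: add0r. Qed.

Theorem proposition4p3 (S : pzSemiRingType) (Sum : summation S)
    (S_complete : is_complete_semiring Sum) (C : strictMonoidalCategory) :
  forms_complete_semiring (Qadd S C) (Qmul Sum C) (Qzero S C) (Qone S C)
    (Qsum Sum C).
Proof.
(* The decidable equality and the choice operator come from classical logic. *)
pose QN := GRing.isNmodule.Build (Q S C) (@QaddA S C) (@QaddC S C) (@Qadd0l S C).
pose QNmod : nmodType :=
  HB.pack (Q S C) (gen_eqMixin (Q S C)) (gen_choiceMixin (Q S C)) QN.
pose QR := GRing.Nmodule_isPzSemiRing.Build QNmod (QmulA S_complete (C := C))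
  (Qmul1l S_complete (C := C)) (Qmul1r S_complete (C := C))
  (QmulDl S_complete (C := C)) (QmulDr S_complete (C := C))
  (Qmul0l S_complete (C := C)) (Qmul0r S_complete (C := C)).
pose QRing : pzSemiRingType := HB.pack QNmod QR.
exists (GRing.PzSemiRing.class QRing); split=> //.
have S_monoid := complete_semiring_monoid S_complete.
split; first split.
- by move=> I f I0; apply: Q_ext => X Y gamma; apply: (sum_empty S_monoid).
- move=> I f i1 I1; apply: Q_ext => X Y gamma.
  exact: (sum_singleton S_monoid (fun i => f i X Y gamma)).
- move=> I f i1 i2 i12 I2; apply: Q_ext => X Y gamma.
  exact: (sum_pair S_monoid (fun i => f i X Y gamma)).
- move=> I J P f part; apply: Q_ext => X Y gamma.
  exact: (sum_partition S_monoid (fun i => f i X Y gamma)).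
- by move=> I f g; apply: Qmul_sumr.
- by move=> I f g; apply: Qmul_suml.
Qed.
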